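(* Let $r\ge 3$ and $s\ge 1$ be integers and let $\Gamma_{M_{2rs}}$ be the non-commuting graph of the group $M_{2rs}=\langle a,b : a^r=b^{2s}=1,\ bab^{-1}=a^{-1}\rangle$ of order $2rs$. Then: (a) $E(\Gamma_{M_{2rs}})\le LE^+(\Gamma_{M_{2rs}})\le LE(\Gamma_{M_{2rs}})$, and equality holds (in either inequality) if and only if $r=4$ (i.e. the group is $M_{8s}$). (b) $\Gamma_{M_{2rs}}$ is neither hypoenergetic nor hyperenergetic. (c) If $r=3$ and $s=1$ (the group $M_6$), then $\Gamma_{M_{2rs}}$ is L-hyperenergetic but not Q-hyperenergetic. If $r=4$ (the groups $M_{8s}$), then $\Gamma_{M_{2rs}}$ is neither L-hyperenergetic nor Q-hyperenergetic. If $(r,s)\neq(3,1)$ and $r\ne 4$ (i.e. $2rs\neq 6$ and $2rs\ne 8s$), then $\Gamma_{M_{2rs}}$ is both Q-hyperenergetic and L-hyperenergetic.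
   Context: For a finite non-abelian group $G$ with center $Z(G)$, the non-commuting graph $\Gamma_G$ is the simple undirected graph with vertex set $G\setminus Z(G)$ in which $x,y$ are adjacent iff $xy\ne yx$. For a finite simple graph $\mathcal G$ with vertex set $v(\mathcal G)$, edge set $e(\mathcal G)$, adjacency matrix $A(\mathcal G)$ and diagonal degree matrix $D(\mathcal G)$, put $L(\mathcal G)=D(\mathcal G)-A(\mathcal G)$ (Laplacian) and $Q(\mathcal G)=D(\mathcal G)+A(\mathcal G)$ (signless Laplacian). With sums over eigenvalues counted with multiplicity, define $E(\mathcal G)=\sum_{\lambda}|\lambda|$ ($\lambda$ eigenvalues of $A(\mathcal G)$), $LE(\mathcal G)=\sum_{\beta}\left|\beta-\frac{2|e(\mathcal G)|}{|v(\mathcal G)|}\right|$ ($\beta$ eigenvalues of $L(\mathcal G)$), $LE^+(\mathcal G)=\sum_{\gamma}\left|\gamma-\frac{2|e(\mathcal G)|}{|v(\mathcal G)|}\right|$ ($\gamma$ eigenvalues of $Q(\mathcal G)$). With $K_n$ the complete graph on $n$ vertices, $\mathcal G$ is called hyperenergetic if $E(\mathcal G)>E(K_{|v(\mathcal G)|})$, hypoenergetic if $E(\mathcal G)<|v(\mathcal G)|$, L-hyperenergetic if $LE(\mathcal G)>LE(K_{|v(\mathcal G)|})$, and Q-hyperenergetic if $LE^+(\mathcal G)>LE^+(K_{|v(\mathcal G)|})$. *)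

(* Defs.v *)
From mathcomp Require Export all_boot all_order all_algebra.
From mathcomp Require Export all_fingroup all_solvable all_field.

Set Implicit Arguments.
Unset Strict Implicit.
Unset Printing Implicit Defensive.

Import Order.TTheory GRing.Theory Num.Theory.

Local Open Scope ring_scope.

Record sgraph := SGraph {
  vertex :> finType;
  adj : rel vertex;
  adj_sym : symmetric adj;
  adj_irr : irreflexive adj }.

Definition edges (g : sgraph) : {set {set g}} :=
  [set [set p.1; p.2] | p : g * g & adj p.1 p.2].

Definition degree (g : sgraph) (x : g) : nat := #|[set y | adj x y]|.

(* All matrices are over the algebraic complex numbers: the eigenvalues of an
   integer matrix are algebraic. *)
Definition adjacency_mx (g : sgraph) : 'M[algC]_#|g| :=
  \matrix_(i, j) (adj (enum_val i : g) (enum_val j))%:R.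

Definition degree_mx (g : sgraph) : 'M[algC]_#|g| :=
  diag_mx (\row_i (degree (enum_val i : g))%:R).

Definition laplacian_mx (g : sgraph) := degree_mx g - adjacency_mx g.

Definition signless_laplacian_mx (g : sgraph) := degree_mx g + adjacency_mx g.

(* The roots of the characteristic polynomial, listed with multiplicity. *)
Definition eigenvalues n (A : 'M[algC]_n) : seq algC :=
  sval (closed_field_poly_normal (char_poly A)).

(* Energies are sums of moduli, so they are real elements of algC, and on
   those the partial order of algC is the usual total order. *)
Definition energy (g : sgraph) : algC :=
  \sum_(l <- eigenvalues (adjacency_mx g)) `|l|.

Definition average_degree (g : sgraph) : algC := (2 * #|edges g|)%:R / #|g|%:R.

Definition laplacian_energy (g : sgraph) : algC :=
  \sum_(b <- eigenvalues (laplacian_mx g)) `|b - average_degree g|.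

Definition signless_laplacian_energy (g : sgraph) : algC :=
  \sum_(c <- eigenvalues (signless_laplacian_mx g)) `|c - average_degree g|.

Section CompleteGraph.
Variable n : nat.

Fact complete_sym : symmetric (fun i j : 'I_n => i != j).
Proof. by move=> i j; rewrite eq_sym. Qed.

Fact complete_irr : irreflexive (fun i j : 'I_n => i != j).
Proof. by move=> i; rewrite eqxx. Qed.

Definition complete_graph : sgraph := SGraph complete_sym complete_irr.

End CompleteGraph.

Definition hyperenergetic (g : sgraph) : Prop :=
  energy (complete_graph #|g|) < energy g.

Definition hypoenergetic (g : sgraph) : Prop := energy g < #|g|%:R.

Definition L_hyperenergetic (g : sgraph) : Prop :=
  laplacian_energy (complete_graph #|g|) < laplacian_energy g.

Definition Q_hyperenergetic (g : sgraph) : Prop :=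
  signless_laplacian_energy (complete_graph #|g|)
    < signless_laplacian_energy g.

Section NonCommutingGraph.
Variables (gT : finGroupType) (G : {group gT}).

Definition noncentral : finType := {x : gT | x \in G :\: 'Z(G)%g}.

Definition noncommuting : rel noncentral :=
  fun x y => (val x * val y != val y * val x)%g.

Fact noncommuting_sym : symmetric noncommuting.
Proof. by move=> x y; rewrite /noncommuting eq_sym. Qed.

Fact noncommuting_irr : irreflexive noncommuting.
Proof. by move=> x; rewrite /noncommuting eqxx. Qed.

Definition noncommuting_graph : sgraph :=
  SGraph noncommuting_sym noncommuting_irr.

End NonCommutingGraph.

(* The presented group is finite (of order 2rs), so the largest finite quotient
   that \isog Grp refers to is the presented group itself. *)
Definition is_M2rs (r s : nat) (gT : finGroupType) (G : {group gT}) : Prop :=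
  (G \isog Grp (a : b : a ^+ r = b ^+ (2 * s) = 1, b * a * b^-1 = a^-1))%g.

(* Main.v *)
Require Import Defs.
From mathcomp Require Import ring lra zify.

(** The subgroup H = <a, b^2> is abelian of index 2 in the non-abelian group G.
Hence two non-central elements commute iff both lie in H or both lie in the
same coset of Z(G) outside H. With z = |Z(G)| and |H| = (k+1) z, the
non-commuting graph is therefore complete multipartite, with one part H \ Z(G)
of size k z and k+1 parts of size z; here (k+1, z) = (r, s) if r is odd and
(r/2, 2s) if r is even. The matrices x - dD - wA of a complete multipartite
graph are low-rank perturbations of diagonal matrices, so Sylvester's identity
yields their determinants and thus all the spectra; the theorem is then a
comparison of explicit functions of k and z. *)

Set Implicit Arguments.
Unset Strict Implicit.
Unset Printing Implicit Defensive.

Import Order.TTheory GRing.Theory Num.Theory.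

Local Open Scope ring_scope.

(** * Determinants of partitioned matrices *)

(** Both sides are read off two block triangular factorizations of the same matrix, with rows [1, A]
    and [- B, 1]. *)
Lemma det_1DmulC (R : comNzRingType) m n (A : 'M[R]_(m, n)) (B : 'M_(n, m)) :
  \det (1%:M + A *m B) = \det (1%:M + B *m A).
Proof.
have eqL : block_mx 1%:M A (- B) 1%:M =
    block_mx 1%:M 0 (- B) 1%:M *m block_mx 1%:M A 0 (1%:M + B *m A) :> 'M[R]_(m + n).
  rewrite mulmx_block !mul1mx mulmx1 mulmx0 (@mul0mx R m n n (1%:M + B *m A)) !addr0 mulNmx.
  by rewrite addrC addrK.
have eqR : block_mx 1%:M A (- B) 1%:M =
    block_mx (1%:M + A *m B) A 0 1%:M *m block_mx 1%:M 0 (- B) 1%:M :> 'M[R]_(m + n).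
  by rewrite mulmx_block !mul1mx !mulmx1 !mulmx0 !add0r mulmxN addrK.
have := eqR; rewrite {}eqL => /(congr1 determinant).
by rewrite !det_mulmx !det_ublock !det_lblock !det1 !mul1r !mulr1.
Qed.

(** Here [M + u v = M (1 + y v)], and Sylvester's identity shrinks the second factor to a 1 x 1
    determinant. A solution [y] stands in for the inverse of [M]. *)
Lemma det_rank1_update (F : fieldType) n (M : 'M[F]_n) (u y : 'cV_n) (v : 'rV_n) :
  M *m y = u -> \det (M + u *m v) = \det M * (1 + (v *m y) 0 0).
Proof.
move=> <-; rewrite -mulmxA -{1}[M]mulmx1 -mulmxDr det_mulmx det_1DmulC.
by rewrite [1%:M + _]mx11_scalar det_scalar1 !mxE.
Qed.

Section PartitionedMatrix.
Variables (F : fieldType) (n k : nat) (p : 'I_n -> 'I_k) (t : 'I_k -> F).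
Variables (u v : F).

Let N q : F := #|[set i | p i == q]|%:R.

Hypothesis t_neq0 : forall q, t q != 0.
Hypothesis tDuN_neq0 : forall q, t q + u * N q != 0.

(** The hypotheses keep all denominators nonzero; characteristic polynomials escape them by
    evaluation at all but finitely many points. *)
Lemma det_partitioned_mx :
  \det (\matrix_(i, j) (t (p i) * (i == j)%:R + u * (p i == p j)%:R + v)) =
  (\prod_i t (p i)) * (\prod_q (1 + u * N q / t q))
    * (1 + v * \sum_q N q / (t q + u * N q)).
Proof.
have sumN (f : 'I_k -> F) : \sum_i f (p i) = \sum_q N q * f q.
  rewrite (partition_big p xpredT) //=; apply: eq_bigr => q _.
  rewrite (eq_bigr (fun=> f q)) => [|i /eqP-> //].
  by rewrite sumr_const mulr_natl /N cardsE.
have sum_delta (I : finType) (f : I -> F) i : \sum_j f j * (i == j)%:R = f i.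
  rewrite (bigD1 i) //= big1 ?addr0 ?eqxx ?mulr1 // => j ji.
  by rewrite eq_sym (negPf ji) mulr0.
(* The matrix is [T (1 + U U') + v 1 1^T] with [T] diagonal: Sylvester's identity
   handles [U U'], and [y] below solves [M y = 1] for the rank-one update. *)
pose T := diag_mx (\row_i t (p i)).
pose U : 'M[F]_(n, k) := \matrix_(i, q) (p i == q)%:R.
pose U' : 'M[F]_(k, n) := \matrix_(q, i) (u / t q * (p i == q)%:R).
pose M := T *m (1%:M + U *m U').
have ME i j : M i j = t (p i) * (i == j)%:R + u * (p i == p j)%:R.
  rewrite /M /T mul_diag_mx !mxE.
  under eq_bigr => q _ do rewrite !mxE mulrC.
  rewrite sum_delta mulrDr [p j == _]eq_sym; congr (_ + _).
  by rewrite mulrA mulrCA divff // mulr1.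
have detM : \det M = (\prod_i t (p i)) * (\prod_q (1 + u * N q / t q)).
  rewrite det_mulmx det_diag det_1DmulC; congr (_ * _).
    by apply: eq_bigr => i _; rewrite mxE.
  rewrite (_ : _ + _ = diag_mx (\row_q (1 + u * N q / t q))).
    by rewrite det_diag; apply: eq_bigr => q _; rewrite mxE.
  apply/matrixP => q q'; rewrite !mxE.
  under eq_bigr => i _ do rewrite !mxE.
  rewrite (sumN (fun r => u / t q * (r == q)%:R * (r == q')%:R)).
  under eq_bigr => r _ do rewrite mulrA [r == q']eq_sym.
  rewrite sum_delta eq_sym; have [->|_] := eqVneq q' q; last by rewrite !mulr0 addr0.
  by rewrite !mulr1 mulrCA mulrA.
move: M ME detM => M ME detM.
pose y : 'cV[F]_n := \col_i (t (p i) + u * N (p i))^-1.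
have My : M *m y = const_mx 1.
  apply/colP => i; rewrite !mxE.
  pose c := (t (p i) + u * N (p i))^-1.
  (* Row [i] of [M] vanishes outside the block of [i], and [y] is constant on that block. *)
  transitivity (\sum_j (t (p i) * (i == j)%:R + u * (p i == p j)%:R) * c).
    apply: eq_bigr => j _; rewrite ME mxE /c; have [<-//|ij] := eqVneq i j.
    have [<-//|_] := eqVneq (p i) (p j); by rewrite !mulr0 addr0 !mul0r.
  rewrite -mulr_suml big_split /= sum_delta -mulr_sumr.
  rewrite (sumN (fun r => (p i == r)%:R)) sum_delta.
  by rewrite mulfV.
rewrite (_ : \matrix_(i, j) _ = M + const_mx 1 *m (const_mx v : 'rV_n)); last first.
  by apply/matrixP => i j; rewrite !mxE ME big_ord1 !mxE mul1r.
rewrite (det_rank1_update _ My) detM; congr (_ * (1 + _)).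
rewrite mxE; under eq_bigr => i _ do rewrite !mxE.
by rewrite -mulr_sumr (sumN (fun q => (t q + u * N q)^-1)).
Qed.
End PartitionedMatrix.

(** The difference times the product of the [X - x] for [x] in [s] vanishes everywhere; in
    characteristic 0 the naturals are too many roots for it. *)
Lemma poly_eq_cofinite (F : numFieldType) (s : seq F) (p q : {poly F}) :
  (forall x, x \notin s -> p.[x] = q.[x]) -> p = q.
Proof.
move=> eq_pq; apply/eqP; rewrite -subr_eq0; set d := p - q.
pose e := d * \prod_(x <- s) ('X - x%:P).
suff : e == 0.
  rewrite mulf_eq0 => /orP[//|/eqP e0].
  by have := monic_prod_XsubC s xpredT id; rewrite e0 monicE lead_coef0 eq_sym oner_eq0.
apply/negP => /negP e_neq0.
have e_root x : root e x.
  rewrite rootM root_prod_XsubC; have [|xs] := boolP (x \in s); first by rewrite orbT.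
  by rewrite orbF /root hornerD hornerN eq_pq // subrr.
have := max_poly_roots (rs := [seq i%:R | i <- iota 0 (size e)]) e_neq0.
rewrite size_map size_iota ltnn map_inj_uniq ?iota_uniq; last exact/mulrIn/oner_neq0.
by move=> /(_ _ isT); rewrite (introT allP) // => /(_ isT).
Qed.

Lemma prod_ord_head (R : comNzRingType) m (c0 c1 : R) :
  \prod_(q < m.+1) (if q == ord0 then c0 else c1) = c0 * c1 ^+ m.
Proof. by rewrite big_ord_recl /= prodr_const card_ord. Qed.

Lemma sum_ord_head (R : nzRingType) m (c0 c1 : R) :
  \sum_(q < m.+1) (if q == ord0 then c0 else c1) = c0 + c1 *+ m.
Proof. by rewrite big_ord_recl /= sumr_const card_ord. Qed.

Section TwoBlockSizes.
Variables (F : fieldType) (n m N z : nat) (p : 'I_n -> 'I_m.+1).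
Variables (t0 t1 u v : F).
Hypotheses (m_gt0 : (0 < m)%N) (N_gt0 : (0 < N)%N) (z_gt0 : (0 < z)%N).
Hypothesis size_blocks : forall q,
  #|[set i | p i == q]| = if q == ord0 then N else z.
Hypotheses (t0_neq0 : t0 != 0) (t1_neq0 : t1 != 0).
Hypotheses (t0D_neq0 : t0 + u * N%:R != 0) (t1D_neq0 : t1 + u * z%:R != 0).

(** One factor [t1 + u z] goes into the last factor to clear its denominators, whence the exponent
    [m.-1]. *)
Lemma det_two_block_sizes :
  let t q := if q == ord0 then t0 else t1 in
  \det (\matrix_(i, j) (t (p i) * (i == j)%:R + u * (p i == p j)%:R + v)) =
  t0 ^+ N.-1 * t1 ^+ (m * z.-1) * (t1 + u * z%:R) ^+ m.-1
    * ((t0 + u * N%:R) * (t1 + u * z%:R)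
       + v * (N%:R * (t1 + u * z%:R) + (m * z)%:R * (t0 + u * N%:R))).
Proof.
move=> t; rewrite det_partitioned_mx; first last.
- by move=> q; rewrite size_blocks /t; case: ifP.
- by move=> q; rewrite /t; case: ifP.
rewrite (partition_big p xpredT) //=.
rewrite (eq_bigr (fun q => if q == ord0 then t0 ^+ N else t1 ^+ z)); last first.
  move=> q _; rewrite (eq_bigr (fun=> t q)) => [|i /eqP-> //].
  by rewrite prodr_const -cardsE size_blocks /t; case: ifP.
rewrite prod_ord_head.
rewrite (eq_bigr (fun q =>
  if q == ord0 then 1 + u * N%:R / t0 else 1 + u * z%:R / t1)); last first.
  by move=> q _; rewrite size_blocks /t; case: ifP.
rewrite prod_ord_head.
rewrite (eq_bigr (fun q =>
  if q == ord0 then N%:R / (t0 + u * N%:R) else z%:R / (t1 + u * z%:R))); last first.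
  by move=> q _; rewrite size_blocks /t; case: ifP.
rewrite sum_ord_head.
case: m N z m_gt0 N_gt0 z_gt0 t0D_neq0 t1D_neq0
  => [//|m'] [//|N'] [//|z'] _ _ _ h0 h1; rewrite !succnK.
have -> : 1 + u * N'.+1%:R / t0 = (t0 + u * N'.+1%:R) / t0 by field.
have -> : 1 + u * z'.+1%:R / t1 = (t1 + u * z'.+1%:R) / t1 by field.
rewrite -[_ *+ m'.+1]mulr_natr natrM expr_div_n -exprM [(z'.+1 * _)%N]mulnC mulnS exprD.
move: (t0 + _) (t1 + _) h0 h1 => a b h0 h1.
rewrite exprS [b ^+ m'.+1]exprS.
move: (t1 ^+ m'.+1) (expf_neq0 m'.+1 t1_neq0) => T T0.
by field; rewrite h0 h1 T0 t0_neq0.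
Qed.
End TwoBlockSizes.

(** * Complete multipartite graphs *)

(** Ordered adjacent pairs are counted in two ways, by first vertex and by the edge they span; over
    an edge lie exactly [(x, y)] and [(y, x)]. *)
Lemma sum_degree (g : sgraph) : (\sum_(x : g) degree x = 2 * #|edges g|)%N.
Proof.
have -> : (\sum_(x : g) degree x = \sum_(p : g * g | adj p.1 p.2) 1)%N.
  rewrite -(pair_big_dep xpredT (fun x y => adj x y) (fun _ _ => 1%N)) /=.
  by apply: eq_bigr => x _; rewrite sum1_card /degree cardsE.
rewrite (partition_big (fun p : g * g => [set p.1; p.2])
  (fun e => e \in edges g)) /=; last first.
  by move=> p adj_p; apply/imsetP; exists p; rewrite ?inE.
rewrite mulnC -sum_nat_const; apply: eq_bigr => _ /imsetP[[x y] /= xy ->].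
have x_neq_y : x != y by apply: contraTneq xy => ->; rewrite inE adj_irr.
rewrite sum1dep_card; transitivity #|[set (x, y); (y, x)]|; last first.
  by rewrite cards2 xpair_eqE negb_and x_neq_y.
apply: eq_card => -[x' y']; rewrite !inE /= !xpair_eqE.
apply/andP/orP => [[x'y' /eqP eq_xy]|].
  have : x' \in [set x; y] by rewrite -eq_xy set21.
  have : y' \in [set x; y] by rewrite -eq_xy set22.
  have x'_neq_y' : x' != y' by apply: contraTneq x'y' => ->; rewrite adj_irr.
  rewrite !inE => /orP[]/eqP? /orP[]/eqP?; subst;
    rewrite ?eqxx in x'_neq_y' *; by [left|right].
by rewrite inE in xy; case=> /andP[/eqP-> /eqP->]; rewrite ?xy // adj_sym xy setUC.
Qed.

Definition multipartite (g : sgraph) (N m z : nat) (p : g -> 'I_m.+1) : Prop :=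
  (forall x y, adj x y = (p x != p y)) /\
  (forall q, #|[set x | p x == q]| = if q == ord0 then N else z).

Section Multipartite.
Variables (g : sgraph) (N m z : nat) (p : g -> 'I_m.+1).
Hypothesis mp_g : multipartite N z p.
Hypotheses (m_gt0 : (0 < m)%N) (N_gt0 : (0 < N)%N) (z_gt0 : (0 < z)%N).

Lemma multipartite_card : #|g| = (N + m * z)%N.
Proof.
have [_ size_p] := mp_g.
rewrite -sum1_card (partition_big p xpredT) //=.
rewrite (eq_bigr (fun q => if q == ord0 then N else z)); last first.
  by move=> q _; rewrite -size_p sum1_card cardsE.
by rewrite big_ord_recl /= sum_nat_const card_ord.
Qed.

Lemma multipartite_degree x :
  degree x = if p x == ord0 then (m * z)%N else (N + m.-1 * z)%N.
Proof.
have [adj_p size_p] := mp_g.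
have := cardsC [set y | p y == p x]; rewrite size_p multipartite_card.
rewrite (_ : ~: _ = [set y | adj x y]); last first.
  by apply/setP => y; rewrite !inE adj_p eq_sym.
by rewrite /degree; case: ifP => _; move: m_gt0; case: (m) => // m'; rewrite ?mulSn; lia.
Qed.

Lemma multipartite_edges :
  (2 * #|edges g| = m * z * (2 * N + m.-1 * z))%N.
Proof.
have [adj_p size_p] := mp_g.
rewrite -sum_degree (partition_big p xpredT) //=.
rewrite (eq_bigr (fun q =>
  if q == ord0 then N * (m * z) else z * (N + m.-1 * z))%N); last first.
  move=> q _.
  rewrite (eq_bigr (fun=> if q == ord0 then (m * z)%N else (N + m.-1 * z)%N)).
    by rewrite sum_nat_const -cardsE size_p; case: ifP.
  by move=> x /eqP <-; rewrite multipartite_degree.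
by rewrite big_ord_recl /= sum_nat_const card_ord; nia.
Qed.

(** Vectors supported on one part with sum zero account for the first two families; those constant
    on parts, zero on part [ord0] and of sum zero account for [e - w z]. The 2 x 2 quotient matrix
    contributes [al] and [be], which enter only through its trace and determinant. *)
Lemma multipartite_char_poly (d w al be : algC) :
    let e := d * (N%:R + (m%:R - 1) * z%:R) in
    al + be = d * (m * z)%:R + e + w * (m%:R - 1) * z%:R ->
    al * be = d * (m * z)%:R * e + w * d * m%:R * (m%:R - 1) * z%:R ^+ 2
              - w ^+ 2 * (m * z * N)%:R ->
  char_poly (d *: degree_mx g + w *: adjacency_mx g) =
  \prod_(l <- nseq N.-1 (d * (m * z)%:R) ++ nseq (m * z.-1) e
           ++ nseq m.-1 (e - w * z%:R) ++ [:: al; be]) ('X - l%:P).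
Proof.
move=> e sum_ab prod_ab.
have [adj_p size_p] := mp_g.
(* Away from these values of [x] no denominator of [det_partitioned_mx] vanishes. *)
pose bad := [:: d * (m * z)%:R; e; d * (m * z)%:R - w * N%:R; e - w * z%:R].
apply: (poly_eq_cofinite (s := bad)) => x.
rewrite !inE !negb_or => /and4P[x1 x2 x3 x4].
rewrite -[LHS]horner_evalE -det_map_mx.
pose t q := if q == ord0 :> 'I_m.+1 then x - d * (m * z)%:R else x - e.
pose p' (i : 'I_#|g|) := p (enum_val i).
have size_p' q : #|[set i | p' i == q]| = if q == ord0 then N else z.
  rewrite -size_p -(card_imset _ enum_val_inj); apply: eq_card => y.
  apply/imsetP/idP => [[i]|]; first by rewrite !inE => ? ->.
  by rewrite inE => py; exists (enum_rank y); rewrite ?inE /p' enum_rankK.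
(* Adjacency is 1 minus the indicator of a common part, so [- w A] yields [u = w] and [v = - w]. *)
have -> : map_mx (horner_eval x) (char_poly_mx (d *: degree_mx g + w *: adjacency_mx g))
    = \matrix_(i, j) (t (p' i) * (i == j)%:R + w * (p' i == p' j)%:R - w).
  apply/matrixP => i j; rewrite !mxE adj_p multipartite_degree -/(p' i) -/(p' j).
  rewrite horner_evalE hornerD hornerN hornerC hornerMn hornerX /t /e.
  have [<-|ij] := eqVneq i j.
    rewrite eqxx !mulr1n !mulr1 mulr0.
    case: eqP => _; first by ring.
    by rewrite natrD natrM -subn1 natrB //; ring.
  rewrite !mulr0n !mulr0.
  by case: eqP => _ /=; ring.
move: e => e in t sum_ab prod_ab bad x2 x4 *.
rewrite (@det_two_block_sizes _ _ m N z) // ?subr_eq0 //; last 2 first.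
- by apply: contraNneq x3 => xE; apply/eqP; rewrite -[RHS]addr0 -xE; ring.
- by apply: contraNneq x4 => xE; apply/eqP; rewrite -[RHS]addr0 -xE; ring.
rewrite horner_prod.
under eq_bigr => l _ do rewrite hornerXsubC.
rewrite !big_cat /= !big_nseq !iter_mulr_1 !big_cons big_nil mulr1.
have -> : x - e + w * z%:R = x - (e - w * z%:R) by ring.
rewrite !mulrA -[RHS]mulrA; congr (_ * _).
have -> : (x - al) * (x - be) = x ^+ 2 - (al + be) * x + al * be by ring.
by rewrite sum_ab prod_ab !natrM; ring.
Qed.
End Multipartite.

Lemma eigenvalues_perm n (A : 'M[algC]_n) s :
  char_poly A = \prod_(l <- s) ('X - l%:P) -> perm_eq (eigenvalues A) s.
Proof.
rewrite /eigenvalues; case: closed_field_poly_normal => /= r.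
by rewrite (monicP (char_poly_monic A)) scale1r => -> /prod_XsubC_eq.
Qed.

(** With singleton parts, the reference graphs fall under the same spectral formulas. *)
Lemma complete_multipartite m :
  multipartite 1 1 (id : complete_graph m.+1 -> 'I_m.+1).
Proof.
split=> // q; rewrite if_same -(cards1 q).
by apply: eq_card => x; rewrite !inE.
Qed.

(* [algC] is only partially ordered, so the closed forms are computed in a real
   closed field embedded in it, eventually [algR]. *)
Section RealEmbedding.
Variables (R : rcfType) (f : {rmorphism R -> algC}).
Hypothesis f_le : {mono f : x y / x <= y}.

Lemma embedding_norm x : `|f x| = f `|x|.
Proof.
have := f_le 0 x; have := f_le x 0; rewrite rmorph0.
have [x0|/ltW x0] := ger0P x => f_npos f_nneg; first exact: ger0_norm.
by rewrite rmorphN; apply: ler0_norm; rewrite f_npos.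
Qed.

Section MultipartiteEnergies.
Variables (g : sgraph) (N m z : nat) (p : g -> 'I_m.+1).
Hypothesis mp_g : multipartite N z p.
Hypotheses (m_gt0 : (0 < m)%N) (N_gt0 : (0 < N)%N) (z_gt0 : (0 < z)%N).

(** One sum serves all three energies: [(d, w)] is [(0, 1)], [(1, -1)] or [(1, 1)], and the centre
    [c] is 0 in the first case, the mean degree in the others. *)
Lemma multipartite_deviation (d w al be c : R) :
    let e := d * (N%:R + (m%:R - 1) * z%:R) in
    al + be = d * (m * z)%:R + e + w * (m%:R - 1) * z%:R ->
    al * be = d * (m * z)%:R * e + w * d * m%:R * (m%:R - 1) * z%:R ^+ 2
              - w ^+ 2 * (m * z * N)%:R ->
  \sum_(l <- eigenvalues (f d *: degree_mx g + f w *: adjacency_mx g)) `|l - f c| =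
  f ((N%:R - 1) * `|d * (m * z)%:R - c| + m%:R * (z%:R - 1) * `|e - c|
     + (m%:R - 1) * `|e - w * z%:R - c| + (`|al - c| + `|be - c|)).
Proof.
move=> e sum_ab prod_ab.
have predE n : (0 < n)%N -> (n.-1)%:R = n%:R - 1 :> R.
  by move=> n0; rewrite -subn1 natrB.
have nat_val n : f n%:R = n%:R by rewrite rmorph_nat.
have /= := multipartite_char_poly mp_g m_gt0 N_gt0 z_gt0
  (d := f d) (w := f w) (al := f al) (be := f be).
rewrite -!nat_val -(rmorph1 f) -!(rmorphB f, rmorphD f, rmorphM f, rmorphXn f) -/e.
move=> /(_ (congr1 f sum_ab) (congr1 f prod_ab))/eigenvalues_perm eigs.
rewrite (perm_big _ eigs) {eigs}.
rewrite !big_cat /= !big_nseq !iter_addr_0 !big_cons big_nil addr0.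
rewrite -!(rmorphB f) !embedding_norm -!(rmorphMn f) -!(rmorphD f); congr (f _).
by rewrite -!predE // -natrM !mulr_natl !addrA.
Qed.

Let c : R := (m * z * (2 * N + m.-1 * z))%:R / (N + m * z)%:R.

Lemma multipartite_energy (al be : R) :
    al + be = (m%:R - 1) * z%:R -> al * be = - (m * z * N)%:R ->
  energy g = f ((m%:R - 1) * z%:R + (`|al| + `|be|)).
Proof.
move=> sum_ab prod_ab.
have -> : energy g = \sum_(l <- eigenvalues
    (f 0 *: degree_mx g + f 1 *: adjacency_mx g)) `|l - f 0|.
  rewrite rmorph0 rmorph1 scale0r add0r scale1r.
  by apply: eq_bigr => l _; rewrite subr0.
rewrite (@multipartite_deviation 0 1 al be 0); last 2 first.
- by rewrite sum_ab; ring.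
- by rewrite prod_ab; ring.
congr (f _).
rewrite !mul0r !subr0 !normr0 !mulr0 !add0r mul1r normrN.
by rewrite [X in _ * X + _]ger0_norm.
Qed.

Lemma average_degreeE : average_degree g = f c.
Proof.
rewrite /average_degree (multipartite_edges mp_g) // (multipartite_card mp_g).
by rewrite fmorph_div !rmorph_nat.
Qed.

Lemma multipartite_laplacian_energy :
  laplacian_energy g =
  f ((N%:R - 1) * `|(m * z)%:R - c|
     + m%:R * (z%:R - 1) * `|N%:R + (m%:R - 1) * z%:R - c|
     + m%:R * `|(N + m * z)%:R - c| + `|c|).
Proof.
rewrite /laplacian_energy average_degreeE.
(* The quotient roots are [N + m z] and 0. As [e + z = N + m z] too, that eigenvalue has
   multiplicity [m]. *)
have := @multipartite_deviation 1 (-1) (N + m * z)%:R 0 c.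
rewrite rmorphN !rmorph1 scale1r scaleN1r -/(laplacian_mx g) => ->.
- congr (f _); rewrite sub0r normrN !mul1r natrD natrM.
  have -> : N%:R + (m%:R - 1) * z%:R - -1 * z%:R = N%:R + m%:R * z%:R :> R by ring.
  by ring.
- by rewrite natrD natrM; ring.
- by rewrite !natrM; ring.
Qed.

Lemma multipartite_signless_laplacian_energy (al be : R) :
    al + be = N%:R + (3 * m%:R - 2) * z%:R ->
    al * be = 2 * m%:R * (m%:R - 1) * z%:R ^+ 2 ->
  signless_laplacian_energy g =
  f ((N%:R - 1) * `|(m * z)%:R - c|
     + m%:R * (z%:R - 1) * `|N%:R + (m%:R - 1) * z%:R - c|
     + (m%:R - 1) * `|N%:R + (m%:R - 2) * z%:R - c| + (`|al - c| + `|be - c|)).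
Proof.
move=> sum_ab prod_ab.
rewrite /signless_laplacian_energy average_degreeE.
have := @multipartite_deviation 1 1 al be c.
rewrite !rmorph1 !scale1r -/(signless_laplacian_mx g) => ->.
- congr (f _); rewrite !mul1r.
  by have -> : N%:R + (m%:R - 1) * z%:R - z%:R = N%:R + (m%:R - 2) * z%:R :> R by ring.
- by rewrite sum_ab natrM; ring.
- by rewrite prod_ab !natrM; ring.
Qed.

End MultipartiteEnergies.
End RealEmbedding.

(** * Comparison of the closed forms *)

Section RealInequalities.
Variables (R : rcfType).
Implicit Types x y K Z : R.

Lemma ler_of_sqr x y : 0 <= y -> x ^+ 2 <= y ^+ 2 -> x <= y.
Proof. by move=> y0 xy; rewrite leNgt; apply/negP => yx; nra. Qed.

Lemma ltr_of_sqr x y : 0 <= y -> x ^+ 2 < y ^+ 2 -> x < y.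
Proof. by move=> y0 xy; rewrite ltNge; apply/negP => yx; nra. Qed.

Lemma sqrt_sqr_ge0 x : 0 <= x -> Num.sqrt x ^+ 2 = x /\ 0 <= Num.sqrt x.
Proof. by move=> x0; rewrite sqr_sqrtr // sqrtr_ge0. Qed.

(* For the complete multipartite graph with one part of size [k z] and [k + 1]
   parts of size [z], where [K] and [Z] are the images of [k] and [z]: the three
   energies divided by [z], and the common value [complete_total] of the three
   energies of the complete graph on as many vertices. *)
Definition scaled_energy K : R := K + Num.sqrt (5 * K ^+ 2 + 4 * K).
Definition scaled_laplacian K Z : R :=
  2 * K * (K ^+ 2 - 1) * Z / (2 * K + 1) + 2 * (K + 1).
Definition scaled_signless K Z : R :=
  (2 * K * (K ^+ 2 - 1) * Z - (K + 1) ^+ 2 * (K - 1)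
    + K * `|K ^+ 2 - 3 * K - 1|) / (2 * K + 1) + Num.sqrt (8 * K ^+ 2 + 1).

Definition complete_total K Z : R := 2 * ((2 * K + 1) * Z - 1).

(** Once the absolute value is opened, the terms without [Z] add up to [1 - 4 K ^ 2], which
    [2 K + 1] divides. *)
Lemma scaled_signless_ge4 K Z : 4 <= K ->
  scaled_signless K Z = 2 * K * (K ^+ 2 - 1) * Z / (2 * K + 1) - (2 * K - 1)
    + Num.sqrt (8 * K ^+ 2 + 1).
Proof.
move=> K4; rewrite /scaled_signless ger0_norm; last by nra.
by congr (_ + _); field; apply: lt0r_neq0; lra.
Qed.

Lemma scaled_signless_2 Z : scaled_signless 2 Z = (12 * Z - 3) / 5 + Num.sqrt 33.
Proof.
rewrite /scaled_signless (_ : 2 ^+ 2 - 3 * 2 - 1 = - 3) ?normrN ?ger0_norm //; last by ring.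
congr (_ + Num.sqrt _); by [field | ring].
Qed.

Lemma scaled_signless_3 Z : scaled_signless 3 Z = (48 * Z - 29) / 7 + Num.sqrt 73.
Proof.
rewrite /scaled_signless (_ : 3 ^+ 2 - 3 * 3 - 1 = - 1) ?normrN ?ger0_norm //; last by ring.
congr (_ + Num.sqrt _); by [field | ring].
Qed.

(** The lower bound brings the scaled energy to at least [2 K + 1], the number of vertices over [z];
    the upper one keeps it within [4 K], below the complete graph. *)
Lemma sqrt_energy_bounds K : 1 <= K -> K + 1 <= Num.sqrt (5 * K ^+ 2 + 4 * K) <= 3 * K.
Proof.
move=> K1; have [|s2 s0] := @sqrt_sqr_ge0 (5 * K ^+ 2 + 4 * K); first by nra.
by apply/andP; split; apply: ler_of_sqr; nra.
Qed.

(** At [K = 1] both radicands are 9 and the three scaled energies agree: this is the equality case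
    [r = 4]. *)
Lemma scaled_energy_1 : scaled_energy 1 = 4.
Proof.
rewrite /scaled_energy (_ : 5 * 1 ^+ 2 + 4 * 1 = 3 ^+ 2); last by ring.
by rewrite sqrtr_sqr ger0_norm //; ring.
Qed.

Lemma scaled_signless_1 Z : scaled_signless 1 Z = 4.
Proof.
rewrite /scaled_signless (_ : 8 * 1 ^+ 2 + 1 = 3 ^+ 2); last by ring.
rewrite (_ : 1 ^+ 2 - 3 * 1 - 1 = - 3); last by ring.
by rewrite sqrtr_sqr normrN !ger0_norm //; field.
Qed.

Lemma scaled_laplacian_1 Z : scaled_laplacian 1 Z = 4.
Proof. by rewrite /scaled_laplacian; field. Qed.

(* [K ^+ 2 - 3 * K - 1] changes sign between 3 and 4. *)
Variant ge2_spec K : Prop :=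
 | Ge2_2 of K = 2 | Ge2_3 of K = 3 | Ge2_4 of 4 <= K.

Lemma ge2P (k : nat) : (2 <= k)%N -> ge2_spec k%:R.
Proof.
case: k => [|[|[|[|k]]]] // _; [exact: Ge2_2 | exact: Ge2_3 |].
by apply: Ge2_4; rewrite ler_nat.
Qed.

Lemma scaled_energy_lt_signless K Z :
  ge2_spec K -> 1 <= Z -> scaled_energy K < scaled_signless K Z.
Proof.
move=> hK Z1; case: hK => [->|->|K4].
- rewrite scaled_signless_2 /scaled_energy (_ : 5 * 2 ^+ 2 + 4 * 2 = 28); last by ring.
  have [//|s2 s0] := @sqrt_sqr_ge0 28; have [//|t2 t0] := @sqrt_sqr_ge0 33.
  have : Num.sqrt 28 <= 53 / 10 :> R by apply: ler_of_sqr; lra.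
  have : 57 / 10 <= Num.sqrt 33 :> R by apply: ler_of_sqr; lra.
  lra.
- rewrite scaled_signless_3 /scaled_energy (_ : 5 * 3 ^+ 2 + 4 * 3 = 57); last by ring.
  have [//|s2 s0] := @sqrt_sqr_ge0 57; have [//|t2 t0] := @sqrt_sqr_ge0 73.
  have : Num.sqrt 57 <= 76 / 10 :> R by apply: ler_of_sqr; lra.
  have : 85 / 10 <= Num.sqrt 73 :> R by apply: ler_of_sqr; lra.
  lra.
rewrite scaled_signless_ge4 // /scaled_energy.
have [|s2 s0] := @sqrt_sqr_ge0 (5 * K ^+ 2 + 4 * K); first by nra.
have [|t2 t0] := @sqrt_sqr_ge0 (8 * K ^+ 2 + 1); first by nra.
have : Num.sqrt (5 * K ^+ 2 + 4 * K) <= Num.sqrt (8 * K ^+ 2 + 1).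
  by rewrite ler_sqrt; nra.
(* The bound is the summand [K] of the energy plus the [2 K - 1] subtracted on the signless side. *)
have : 3 * K - 1 < 2 * K * (K ^+ 2 - 1) * Z / (2 * K + 1).
  rewrite ltr_pdivlMr; last by lra.
  have : 2 * K * (K ^+ 2 - 1) * 1 <= 2 * K * (K ^+ 2 - 1) * Z by apply: ler_wpM2l; nra.
  by nra.
lra.
Qed.

(** The terms in [Z] are the same on both sides, which leaves a comparison in [K] alone. *)
Lemma scaled_signless_lt_laplacian K Z :
  ge2_spec K -> scaled_signless K Z < scaled_laplacian K Z.
Proof.
case=> [->|->|K4].
- rewrite scaled_signless_2 /scaled_laplacian; have [//|t2 t0] := @sqrt_sqr_ge0 33.
  have : Num.sqrt 33 <= 6 :> R by apply: ler_of_sqr; lra.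
  rewrite (_ : 2 * 2 * (2 ^+ 2 - 1) * Z / (2 * 2 + 1) = 12 / 5 * Z); last by field.
  lra.
- rewrite scaled_signless_3 /scaled_laplacian; have [//|t2 t0] := @sqrt_sqr_ge0 73.
  have : Num.sqrt 73 <= 9 :> R by apply: ler_of_sqr; lra.
  rewrite (_ : 2 * 3 * (3 ^+ 2 - 1) * Z / (2 * 3 + 1) = 48 / 7 * Z); last by field.
  lra.
rewrite scaled_signless_ge4 // /scaled_laplacian.
have [|t2 t0] := @sqrt_sqr_ge0 (8 * K ^+ 2 + 1); first by nra.
have : Num.sqrt (8 * K ^+ 2 + 1) < 4 * K + 1 by apply: ltr_of_sqr; nra.
lra.
Qed.

(** The inequality fails at [(2, 1)], the group of order 6, and at [(3, 1)], which no group here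
    attains: [z = 1] forces [r] odd, hence [k] even. *)
Lemma complete_lt_signless K Z :
  ge2_spec K -> 1 <= Z -> 4 <= K \/ 2 <= Z ->
  complete_total K Z < Z * scaled_signless K Z.
Proof.
have large (t : R) : 4 <= t -> 1 <= Z -> complete_total t Z < Z * scaled_signless t Z.
  move=> K4 Z1; rewrite scaled_signless_ge4 // /complete_total.
  have [|t2 t0] := @sqrt_sqr_ge0 (8 * t ^+ 2 + 1); first by nra.
  have root : (5 * t + 2) / 2 <= Num.sqrt (8 * t ^+ 2 + 1) by apply: ler_of_sqr; nra.
  have coef : 7 / 2 * t - 7 / 10 <= 2 * t * (t ^+ 2 - 1) / (2 * t + 1).
    rewrite ler_pdivlMr; last by lra.
    (* After clearing the denominator, the two sides differ by this product plus [3 / 10]. *)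
    have : 0 <= (t - 4) * (2 * t ^+ 2 + t - 1 / 10) by apply: mulr_ge0; nra.
    by lra.
  rewrite [_ * Z / _]mulrAC; move: (2 * t * _ / _) coef => c coef.
  move: (Num.sqrt _) root {t2 t0} => q root.
  have : Z * ((7 / 2 * t - 7 / 10) * Z - (2 * t - 1) + (5 * t + 2) / 2)
      <= Z * (c * Z - (2 * t - 1) + q).
    apply: ler_wpM2l; first by lra.
    have Z0 : 0 <= Z by lra.
    have := ler_wpM2r Z0 coef; lra.
  apply: lt_le_trans.
  (* This reduces the claim to [t = 4], where [133 / 10 Z ^ 2 - 14 Z + 2] is positive for
     [Z >= 1]. *)
  have : 0 <= (t - 4) * (Z * (Z - 1)) by apply: mulr_ge0; nra.
  nra.
move=> hK Z1; case: hK => [->|->|K4 _]; last exact: large.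
- case=> [|Z2]; first by lra.
  rewrite scaled_signless_2 /complete_total; have [//|t2 t0] := @sqrt_sqr_ge0 33.
  have : 57 / 10 <= Num.sqrt 33 :> R by apply: ler_of_sqr; lra.
  by nra.
- case=> [|Z2]; first by lra.
  rewrite scaled_signless_3 /complete_total; have [//|t2 t0] := @sqrt_sqr_ge0 73.
  have : 85 / 10 <= Num.sqrt 73 :> R by apply: ler_of_sqr; lra.
  by nra.
Qed.

Lemma complete_between_signless_laplacian_2_1 :
  scaled_signless 2 1 <= complete_total 2 1 /\
  complete_total 2 1 < scaled_laplacian 2 1.
Proof.
rewrite scaled_signless_2 /complete_total /scaled_laplacian.
have [//|t2 t0] := @sqrt_sqr_ge0 33.
have : Num.sqrt 33 <= 6 :> R by apply: ler_of_sqr; lra.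
rewrite (_ : 2 * 2 * (2 ^+ 2 - 1) * 1 / (2 * 2 + 1) = 12 / 5); last by field.
lra.
Qed.

(** Twice the edges over the vertices, [3 k (k + 1) z ^ 2] over [(2 k + 1) z]. *)
Definition mean_degree K Z : R := 3 * K * (K + 1) * Z / (2 * K + 1).

(** Every difference is [Z / (2 K + 1)] times a quadratic in [K]; only [K ^ 2 - 3 K - 1] changes
    sign on [K >= 1]. *)
Lemma mean_degree_dist K Z (c := mean_degree K Z) : 1 <= K -> 1 <= Z ->
  [/\ `|(K + 1) * Z - c| = Z * (K ^+ 2 - 1) / (2 * K + 1),
  `|2 * K * Z - c| = Z * (K * (K - 1)) / (2 * K + 1),
  `|(2 * K - 1) * Z - c| = Z * `|K ^+ 2 - 3 * K - 1| / (2 * K + 1),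
  `|(2 * K + 1) * Z - c| = Z * (K ^+ 2 + K + 1) / (2 * K + 1) & `|c| = c].
Proof.
move=> K1 Z1.
have D0 : 0 < 2 * K + 1 by lra.
have Dn0 := lt0r_neq0 D0.
have Z0 : 0 <= Z by lra.
have normE x y : x = Z * y / (2 * K + 1) -> `|x| = Z * `|y| / (2 * K + 1).
  by move=> ->; rewrite !normrM normfV (ger0_norm Z0) (gtr0_norm D0).
split.
- rewrite (normE _ (1 - K ^+ 2)); last by rewrite /c /mean_degree; field.
  by rewrite ler0_norm ?opprB //; nra.
- rewrite (normE _ (K * (K - 1))); last by rewrite /c /mean_degree; field.
  by rewrite ger0_norm //; nra.
- by rewrite (normE _ (K ^+ 2 - 3 * K - 1)) // /c /mean_degree; field.
- rewrite (normE _ (K ^+ 2 + K + 1)); last by rewrite /c /mean_degree; field.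
  by rewrite ger0_norm //; nra.
by rewrite ger0_norm // divr_ge0 //; nra.
Qed.

Lemma laplacian_deviationE K Z (c := mean_degree K Z) : 1 <= K -> 1 <= Z ->
  (K * Z - 1) * `|(K + 1) * Z - c| + (K + 1) * (Z - 1) * `|2 * K * Z - c|
     + (K + 1) * `|(2 * K + 1) * Z - c| + `|c| = Z * scaled_laplacian K Z.
Proof.
move=> K1 Z1; have [-> -> _ -> ->] := mean_degree_dist K1 Z1.
by rewrite /mean_degree /scaled_laplacian; field; apply: lt0r_neq0; lra.
Qed.

Lemma signless_deviationE K Z (c := mean_degree K Z) : 1 <= K -> 1 <= Z ->
  let t := Num.sqrt (8 * K ^+ 2 + 1) in
  (K * Z - 1) * `|(K + 1) * Z - c| + (K + 1) * (Z - 1) * `|2 * K * Z - c|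
     + K * `|(2 * K - 1) * Z - c|
     + (`|Z * (4 * K + 1 + t) / 2 - c| + `|Z * (4 * K + 1 - t) / 2 - c|)
  = Z * scaled_signless K Z.
Proof.
move=> K1 Z1 t; have [-> -> -> _ _] := mean_degree_dist K1 Z1.
have [|t2 t0] := @sqrt_sqr_ge0 (8 * K ^+ 2 + 1); first by nra.
rewrite -/t in t2 t0.
have D0 : 0 < 2 * K + 1 by lra.
have t2K : 2 * K <= t by apply: ler_of_sqr; nra.
(* Measured from the midpoint of the two quotient roots, the mean degree lies between them, so their
   deviations add up to [Z t]. *)
have cE : mean_degree K Z = Z * ((4 * K + 1) / 2 - (2 * K ^+ 2 + 1) / (2 * K + 1) / 2).
  by rewrite /c /mean_degree; field; apply: lt0r_neq0; lra.
have r_t : (2 * K ^+ 2 + 1) / (2 * K + 1) <= t by rewrite ler_pdivrMr //; nra.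
have r_0 : 0 <= (2 * K ^+ 2 + 1) / (2 * K + 1) by rewrite divr_ge0 //; nra.
rewrite (@ger0_norm _ (Z * (4 * K + 1 + t) / 2 - mean_degree K Z)); last by rewrite cE; nra.
rewrite (@ler0_norm _ (Z * (4 * K + 1 - t) / 2 - mean_degree K Z)); last by rewrite cE; nra.
rewrite /scaled_signless -/t; field; exact: lt0r_neq0.
Qed.

End RealInequalities.

(** * Energies of the graphs with parts of sizes k z, z, ..., z *)

Section EnergyFormulas.
Variables (R : rcfType) (f : {rmorphism R -> algC}).
Hypothesis f_le : {mono f : x y / x <= y}.

(** The graph is [m]-regular, so both Laplacian spectra, recentred at [m], are up to sign the
    adjacency spectrum [m, -1, ..., -1]. *)
Lemma complete_energies m : (0 < m)%N ->
  [/\ energy (complete_graph m.+1) = f (2 * m%:R),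
      laplacian_energy (complete_graph m.+1) = f (2 * m%:R)
    & signless_laplacian_energy (complete_graph m.+1) = f (2 * m%:R)].
Proof.
move=> m_gt0; have mp := complete_multipartite m.
have m1 : 1 <= m%:R :> R by rewrite ler1n.
have avg : (m * 1 * (2 * 1 + m.-1 * 1))%:R / (1 + m * 1)%:R = m%:R :> R.
  have -> : (m * 1 * (2 * 1 + m.-1 * 1) = m * (1 + m * 1))%N by nia.
  by rewrite natrM mulfK // pnatr_eq0.
split.
- rewrite (multipartite_energy f_le mp _ _ _ (al := m%:R) (be := - 1)) //; last 2 first.
  + by ring.
  + by rewrite !muln1; ring.
  by rewrite normrN normr1 ger0_norm //; congr (f _); ring.
- rewrite (multipartite_laplacian_energy f_le mp) // avg; congr (f _).
  rewrite subrr !mul0r mulr0 mul0r muln1 natrD addrK normr1 ger0_norm //; ring.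
rewrite (multipartite_signless_laplacian_energy f_le mp _ _ _
  (al := 2 * m%:R) (be := m%:R - 1)) //; last 2 first.
- by ring.
- by ring.
rewrite avg; congr (f _); rewrite subrr !mul0r mulr0 mul0r.
have -> : 1 + (m%:R - 2) * 1 - m%:R = - 1 :> R by ring.
have -> : 2 * m%:R - m%:R = m%:R :> R by ring.
have -> : m%:R - 1 - m%:R = - 1 :> R by ring.
by rewrite normrN normr1 ger0_norm //; ring.
Qed.

Section Blowup.
Variables (g : sgraph) (k z : nat) (p : g -> 'I_k.+2).
Hypothesis mp_g : multipartite (k * z) z p.
Hypotheses (k_gt0 : (0 < k)%N) (z_gt0 : (0 < z)%N).

Let K : R := k%:R.
Let Z : R := z%:R.

Lemma blowup_energies :
  [/\ energy g = f (Z * scaled_energy K),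
      laplacian_energy g = f (Z * scaled_laplacian K Z)
    & signless_laplacian_energy g = f (Z * scaled_signless K Z)].
Proof.
have K1 : 1 <= K by rewrite ler1n.
have Z1 : 1 <= Z by rewrite ler1n.
have N_gt0 : (0 < k * z)%N by rewrite muln_gt0 k_gt0.
have kE : k.+1%:R = K + 1 by rewrite -addn1 natrD.
have avg : (k.+1 * z * (2 * (k * z) + k.+1.-1 * z))%:R / (k * z + k.+1 * z)%:R
    = mean_degree K Z.
  rewrite succnK !(natrM, natrD) kE -/K -/Z /mean_degree; field.
  by apply/andP; split; apply: lt0r_neq0; nra.
have eE : (k * z)%:R + (k.+1%:R - 1) * z%:R = 2 * K * Z.
  by rewrite natrM kE -/K -/Z; ring.
split.
- have /andP[s_ge _] := sqrt_energy_bounds K1; set s := Num.sqrt _ in s_ge.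
  have [|s2 _] := @sqrt_sqr_ge0 _ (5 * K ^+ 2 + 4 * K); first by nra.
  rewrite -/s in s2.
  (* The roots of [X ^ 2 - K Z X - K (K + 1) Z ^ 2]. *)
  rewrite (multipartite_energy f_le mp_g _ _ _
    (al := Z * (K + s) / 2) (be := Z * (K - s) / 2)) //.
  + congr (f _); rewrite kE -/Z ger0_norm; last by nra.
    by rewrite ler0_norm; [rewrite /scaled_energy -/s; field | nra].
  + by rewrite kE -/Z; field.
  rewrite !natrM kE -/K -/Z.
  have -> : Z * (K + s) / 2 * (Z * (K - s) / 2) = Z ^+ 2 * (K ^+ 2 - s ^+ 2) / 4 by field.
  by rewrite s2; field.
- rewrite (multipartite_laplacian_energy f_le mp_g) // avg; congr (f _).
  rewrite -(laplacian_deviationE K1 Z1) eE !natrM natrD !natrM kE -/K -/Z.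
  by have -> : K * Z + (K + 1) * Z = (2 * K + 1) * Z by ring;
    have -> : K + 1 - 1 = K by ring.
set t := Num.sqrt (8 * K ^+ 2 + 1).
have [|t2 _] := @sqrt_sqr_ge0 _ (8 * K ^+ 2 + 1); first by nra.
rewrite -/t in t2.
(* The roots of [X ^ 2 - (4 K + 1) Z X + 2 K (K + 1) Z ^ 2]. *)
rewrite (multipartite_signless_laplacian_energy f_le mp_g _ _ _
  (al := Z * (4 * K + 1 + t) / 2) (be := Z * (4 * K + 1 - t) / 2)) //.
- rewrite avg -(signless_deviationE K1 Z1) eE !natrM kE -/K -/Z -/t; congr (f _).
  have -> : K * Z + (K + 1 - 2) * Z = (2 * K - 1) * Z by ring.
  by have -> : K + 1 - 1 = K by ring.
- by rewrite natrM kE -/K -/Z; field.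
rewrite kE -/Z.
have -> : Z * (4 * K + 1 + t) / 2 * (Z * (4 * K + 1 - t) / 2)
  = Z ^+ 2 * ((4 * K + 1) ^+ 2 - t ^+ 2) / 4 by field.
by rewrite t2; field.
Qed.

Lemma blowup_complete_energies :
  [/\ energy (complete_graph #|g|) = f (complete_total K Z),
      laplacian_energy (complete_graph #|g|) = f (complete_total K Z)
    & signless_laplacian_energy (complete_graph #|g|) = f (complete_total K Z)].
Proof.
have [m [m_gt0 cardE]] : exists m, (0 < m)%N /\ (k * z + k.+1 * z = m.+1)%N.
  by exists (k * z + k.+1 * z).-1; split; nia.
rewrite (multipartite_card mp_g) cardE (_ : complete_total K Z = 2 * m%:R).
  exact: complete_energies.
have : (k * z + k.+1 * z)%:R = m.+1%:R :> R by rewrite cardE.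
by rewrite -[k.+1]addn1 -[m.+1]addn1 !(natrD, natrM) -/K -/Z /complete_total => mE; lra.
Qed.

(** For the groups, [k = 1] will mean [r = 4], and [(k, z) = (2, 1)] will mean [(r, s) = (3, 1)]. *)
Lemma blowup_comparison :
  let E := energy g in let LE := laplacian_energy g in
  let QE := signless_laplacian_energy g in
  [/\ E <= QE /\ QE <= LE /\ (E = QE <-> k = 1) /\ (QE = LE <-> k = 1),
      ~ hypoenergetic g /\ ~ hyperenergetic g,
      k = 2 -> z = 1 -> L_hyperenergetic g /\ ~ Q_hyperenergetic g,
      k = 1 -> ~ L_hyperenergetic g /\ ~ Q_hyperenergetic g
    & (1 < k)%N -> (3 < k)%N || (1 < z)%N ->
      Q_hyperenergetic g /\ L_hyperenergetic g].
Proof.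
rewrite /hypoenergetic /hyperenergetic /L_hyperenergetic /Q_hyperenergetic /=.
have [-> -> ->] := blowup_energies; have [-> -> ->] := blowup_complete_energies.
have f_lt x y : (f x < f y) = (x < y) by rewrite (leW_mono f_le).
have cardE : #|g|%:R = f ((2 * K + 1) * Z).
  rewrite (multipartite_card mp_g) -(rmorph_nat f) -[k.+1]addn1 !(natrD, natrM) -/K -/Z.
  by congr (f _); ring.
rewrite cardE !f_le !f_lt.
have K1 : 1 <= K by rewrite ler1n.
have Z1 : 1 <= Z by rewrite ler1n.
have Z0 : 0 < Z by lra.
have k_cases : k = 1 \/ ((1 < k)%N /\ ge2_spec K).
  have [k2|] := ltnP 1 k; last by left; lia.
  by right; split=> //; apply: ge2P.
split.
- rewrite !ler_pM2l //; case: k_cases => [k1|[k2 hK]].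
    by rewrite /K k1 scaled_energy_1 scaled_signless_1 scaled_laplacian_1 !lexx.
  have EQ := scaled_energy_lt_signless hK Z1.
  have QL := scaled_signless_lt_laplacian Z hK.
  have k1 : k <> 1 by lia.
  rewrite !ltW //; do 2!split=> //.
  by split; split=> // /fmorph_inj/(mulfI (lt0r_neq0 Z0)) H; rewrite H ltxx in EQ QL.
- have /andP[s1 s2] := sqrt_energy_bounds K1.
  by split; apply/negP; rewrite -leNgt /scaled_energy ?/complete_total; nra.
- rewrite /K /Z => -> ->; have [QK KL] := complete_between_signless_laplacian_2_1 R.
  by rewrite !mul1r; split=> //; apply/negP; rewrite -leNgt.
- rewrite /K => ->; rewrite scaled_signless_1 scaled_laplacian_1.
  by split; apply/negP; rewrite -leNgt /complete_total; lra.
move=> k2 kz; have hK : ge2_spec K by apply: ge2P.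
have KQ : complete_total K Z < Z * scaled_signless K Z.
  by apply: complete_lt_signless => //; case/orP: kz; [left | right]; rewrite ler_nat.
split=> //; apply: lt_trans KQ _.
by rewrite ltr_pM2l //; apply: scaled_signless_lt_laplacian.
Qed.

End Blowup.
End EnergyFormulas.

(** * Groups with an abelian subgroup of index two *)

Section AbelianIndexTwo.
Local Open Scope nat_scope.
Local Open Scope group_scope.

Variables (gT : finGroupType) (G H : {group gT}).
Hypotheses (sHG : H \subset G) (indexGH : #|G : H| = 2) (abelH : abelian H).
Hypothesis nabelG : ~~ abelian G.

Let lcoset_out x : x \in G :\: H -> G :\: H = x *: H.
Proof.
case/setDP=> Gx nHx; apply/esym/eqP; rewrite eqEcard; apply/andP; split.
  apply/subsetP => _ /lcosetP[h Hh ->].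
  by rewrite inE groupMr // nHx groupM // (subsetP sHG).
rewrite card_lcoset; have := Lagrange sHG; rewrite indexGH -(cardsID H G).
by rewrite (setIidPr sHG) muln2 -addnn => /addnI <-.
Qed.

(** [G] is the union of the abelian [H] and [x H]. *)
Let central_of_commute x h :
  x \in G :\: H -> h \in H -> commute h x -> h \in 'Z(G).
Proof.
move=> GHx Hh chx; apply/centerP; split=> [|y Gy]; first exact: (subsetP sHG).
have [Hy|nHy] := boolP (y \in H); first exact: (centsP abelH).
have : y \in G :\: H by rewrite inE nHy.
rewrite (lcoset_out GHx) => /lcosetP[h' Hh' ->].
by apply: commuteM => //; apply: (centsP abelH).
Qed.

(** A central element outside [H] would make [H] central, and then its coset too, hence all of
    [G]. *)
Lemma center_sub_abelian_index2 : 'Z(G) \subset H.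
Proof.
apply/subsetP => x Zx; apply: contraR nabelG => nHx.
have Gx : x \in G := subsetP (center_sub G) x Zx.
have GHx : x \in G :\: H by rewrite inE nHx.
have /centerP[_ cx] := Zx.
suff sGZ : G \subset 'Z(G) by apply: abelianS sGZ (center_abelian G).
have sHZ h : h \in H -> h \in 'Z(G).
  by move=> Hh; apply: (central_of_commute GHx) => //; apply/commute_sym/cx/(subsetP sHG).
apply/subsetP => y Gy; have [/sHZ//|nHy] := boolP (y \in H).
have : y \in G :\: H by rewrite inE nHy.
by rewrite (lcoset_out GHx) => /lcosetP[h Hh ->]; rewrite groupM // sHZ.
Qed.

Variables k z : nat.
Hypotheses (cardZ : #|'Z(G)| = z) (cardH : #|H| = (k.+1 * z)%N).

(** For [x] and [y] outside [H], commuting means that [x^-1 y], which lies in [H], commutes with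
    [x], that is, that it is central. *)
Lemma noncommuting_graph_multipartite :
  exists p : noncommuting_graph G -> 'I_k.+2, multipartite (k * z) z p.
Proof.
have sZH := center_sub_abelian_index2.
have [x0 GHx0] : exists x, x \in G :\: H.
  apply/set0Pn; rewrite -card_gt0 cardsD (setIidPr sHG) -(Lagrange sHG) indexGH.
  by rewrite muln2 -addnn addnK cardG_gt0.
have [Gx0 nHx0] := setDP GHx0.
have out y : y \in G :\: H -> x0^-1 * y \in H.
  by rewrite (lcoset_out GHx0) mem_lcoset.
pose cosets := enum (lcosets 'Z(G) H).
have size_cosets : size cosets = k.+1.
  rewrite -cardE card_lcosets -divgS // cardH cardZ mulnK //.
  by rewrite -cardZ cardG_gt0.
pose C y := (x0^-1 * y) *: 'Z(G).
have C_mem y : y \in G :\: H -> C y \in cosets.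
  by move=> GHy; rewrite mem_enum; apply/lcosetsP; exists (x0^-1 * y); rewrite ?out.
have C_lt y : y \in G :\: H -> index (C y) cosets < k.+1.
  by move=> GHy; rewrite -size_cosets index_mem C_mem.
pose v (x : noncommuting_graph G) : gT := val (x : noncentral G).
have v_inj : injective v by exact: val_inj.
have vP x : v x \in G :\: 'Z(G) by exact: (valP (x : noncentral G)).
(* Translation by [x0^-1] moves the outer cosets of the center into [H], where there are [k + 1] of
   them; the successor reserves [ord0] for [H]. *)
pose p (x : noncommuting_graph G) : 'I_k.+2 :=
  if v x \in H then ord0 else inord (index (C (v x)) cosets).+1.
have p_out x : v x \notin H -> val (p x) = (index (C (v x)) cosets).+1.
  move=> nHx; rewrite /p (negPf nHx) /= inordK // ltnS C_lt // inE nHx.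
  by have /setDP[] := vP x.
have C_eq x y : (C x == C y) = (x^-1 * y \in 'Z(G)).
  rewrite eq_sym; apply/eqP/idP => [Cxy|Zxy].
    have : x0^-1 * y \in C x by rewrite -Cxy lcoset_refl.
    by rewrite mem_lcoset invMg invgK mulgA mulgK.
  by apply/lcoset_eqP; rewrite mem_lcoset invMg invgK mulgA mulgK.
exists p; split=> [x y|q].
  have /setDP[Gx nZx] := vP x; have /setDP[Gy nZy] := vP y.
  rewrite /adj /= /noncommuting -/(v x) -/(v y); congr (~~ _).
  have [Hx|nHx] := boolP (v x \in H); have [Hy|nHy] := boolP (v y \in H).
  - by rewrite /p Hx Hy eqxx; apply/eqP; apply: (centsP abelH).
  - rewrite [RHS](_ : _ = false); last first.
      by rewrite -val_eqE (p_out y) // /p Hx.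
    apply: contraNF nZx => /eqP cxy; apply: central_of_commute cxy => //.
    by rewrite inE nHy.
  - rewrite [RHS](_ : _ = false); last first.
      by rewrite -val_eqE (p_out x) // /p Hy.
    apply: contraNF nZy => /eqP cxy; apply: central_of_commute (esym cxy) => //.
    by rewrite inE nHx.
  have GHx : v x \in G :\: H by rewrite inE nHx.
  have GHy : v y \in G :\: H by rewrite inE nHy.
  rewrite -val_eqE !p_out // eqSS (inj_in_eq (@index_inj _ set0 cosets)) ?C_mem //.
  rewrite C_eq; apply/eqP/idP => [cxy|/centerP[_ cxy]].
    apply: (central_of_commute GHx).
      by have := GHy; rewrite (lcoset_out GHx) mem_lcoset.
    by apply/commute_sym; apply: commuteM => //; apply: commuteV.
  have wx : (v x)^-1 * v y * v x = v y by rewrite (cxy _ Gx) mulKVg.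
  by rewrite -{1}wx -mulgA mulKVg.
have card_val (P : pred gT) :
    #|[set x : noncommuting_graph G | P (v x)]| = #|[set y in G :\: 'Z(G) | P y]|.
  rewrite -(card_imset _ v_inj); apply: eq_card => y; rewrite inE.
  apply/imsetP/andP => [[x]|[Gy Py]]; first by rewrite inE => Px ->; split=> //; exact: vP.
  by exists (Sub y Gy); rewrite ?inE.
have [i ->|->] := unliftP ord0 q; last first.
  transitivity #|[set x : noncommuting_graph G | v x \in H]|.
    apply: eq_card => x; rewrite !inE; have [Hx|nHx] := boolP (v x \in H).
      by rewrite /p Hx eqxx.
    by rewrite -val_eqE p_out.
  rewrite (card_val (fun y => y \in H)) /=.
  have -> : [set y in G :\: 'Z(G) | y \in H] = H :\: 'Z(G).
    by apply/setP => y; rewrite !inE; case Hy: (y \in H);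
      rewrite ?andbF // (subsetP sHG) ?andbT.
  by rewrite cardsD (setIidPr sZH) cardH cardZ mulSn addKn.
transitivity #|[set x : noncommuting_graph G |
                 (v x \notin H) && (index (C (v x)) cosets == i)]|.
  apply: eq_card => x; rewrite !inE; have [Hx|nHx] := boolP (v x \in H).
    by rewrite /p Hx.
  by rewrite -val_eqE p_out // lift0 eqSS.
rewrite (card_val (fun y => (y \notin H) && (index (C y) cosets == i))) /= -cardZ.
have /lcosetsP[h Hh nth_i] : nth set0 cosets i \in lcosets 'Z(G) H.
  by rewrite -mem_enum mem_nth // size_cosets.
(* The part in question is the coset of [x0 h], with [h] taken from the [i]-th coset in [H]. *)
rewrite -(card_lcoset 'Z(G) (x0 * h)); apply: eq_card => y.
rewrite mem_lcoset in_set in_setD.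
have index_i : (y \in G :\: H) -> (index (C y) cosets == i) = (C y == C (x0 * h)).
  move=> GHy; rewrite /C mulKg -nth_i; apply/eqP/eqP => [<-|->].
    by rewrite nth_index ?C_mem.
  by rewrite index_uniq ?enum_uniq // size_cosets.
have [Hy|nHy] := boolP (y \in H); rewrite ?andbF /=.
  apply/esym; apply: contraNF nHx0 => /(subsetP sZH).
  by rewrite groupMr // groupV groupMr.
have [Gy|nGy] := boolP (y \in G); rewrite ?andbF /=; last first.
  apply/esym; apply: contraNF nGy => /(subsetP (center_sub G)).
  by rewrite groupMl // groupV groupM // (subsetP sHG).
have -> : y \notin 'Z(G) by apply: contra nHy; move/(subsetP sZH).
rewrite index_i; last by rewrite inE nHy.
by rewrite eq_sym C_eq.
Qed.
End AbelianIndexTwo.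

(** * The groups M_2rs *)

Section Presentation.
Local Open Scope nat_scope.
Local Open Scope group_scope.

Lemma tight_product (x y c g r t : nat) : 0 < r -> 0 < t -> 0 < c ->
  x <= r -> y <= t -> r * t <= g -> (x * y = g * c)%N -> [/\ x = r, y = t & c = 1%N].
Proof. by move=> *; split; nia. Qed.

(** The number [m] is chosen so that [a ^ i] is central iff [m] divides [i]: it is [r] or [r / 2]
    according to parity, and [z] is the order of the center. *)
Lemma M2rs_parameters (r s : nat) : 2 < r -> 0 < s -> exists m z,
  [/\ r %| 2 * m, forall i, r %| 2 * i -> m %| i, m %| r, (r %/ m * s)%N = z
   & 0 < z /\ (r = m /\ odd r /\ z = s \/ r = (2 * m)%N /\ z = (2 * s)%N)].
Proof.
move=> r_gt2 s_gt0; have [odd_r|even_r] := boolP (odd r).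
  exists r, s; split; rewrite ?dvdn_mull ?dvdnn //; first last.
  - by split; [|left].
  - by rewrite divnn (ltn_trans _ r_gt2) // mul1n.
  by move=> i; rewrite Gauss_dvdr // coprimen2.
have r2 : r = (2 * r./2)%N by rewrite mul2n even_halfK.
exists r./2, (2 * s)%N; split.
- by rewrite -r2.
- by move=> i; rewrite {1}r2 dvdn_pmul2l.
- by rewrite {2}r2 dvdn_mull.
- by rewrite {1}r2 mulnK //; lia.
by split; [lia | right].
Qed.

Variables (r s : nat) (gT : finGroupType) (G : {group gT}).
Hypotheses (r_gt2 : 2 < r) (s_gt0 : 0 < s) (isoG : is_M2rs r s G).

(* The semidirect product of [Z_r] by [Z_2s] satisfies the relations. *)
Lemma leq_card_M2rs : r * (2 * s) <= #|G|.
Proof.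
have r_gt1 : 1 < r by lia.
have p_gt1 : 1 < 2 * s by lia.
rewrite mulnC -(Extremal.card r.-1 p_gt1 r_gt1).
set D := [set: _]; suff homD : D \homg G by rewrite leq_homg.
rewrite isoG.
have := isoGrp_hom (Grp_ext_dihedral r_gt1 p_gt1 (dvdn_mulr s (dvdnn 2))).
case/existsP=> [[x y]] /= /eqP[defD xr ys xy].
apply/existsP; exists (x, y); rewrite /= !xpair_eqE defD xr ys !eqxx /=.
(* The two presentations conjugate by [y] and by [y^-1]; both say that [y] inverts [x]. *)
have <- : x ^ y^-1 = x^-1 by apply: (conjg_inj y); rewrite conjgKV conjVg xy invgK.
by rewrite conjgE invgK mulgA.
Qed.

(** The relations bound the orders of [a] and [b] from above; the lower bound on the order of [G]
    forces equality and a trivial intersection. *)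
Lemma M2rs_generators : exists a b : gT,
  [/\ <[a]> * <[b]> = G, #[a] = r, #[b] = (2 * s)%N, <[a]> :&: <[b]> = 1 & a ^ b = a^-1].
Proof.
have /existsP[[a b] /= /eqP[defG ar bs bab]] := isoGrp_hom isoG.
have ab : a ^ b = a^-1.
  by apply: (conjg_inj b^-1); rewrite conjgK conjVg conjgE invgK mulgA bab invgK.
have defG' : <[a]> * <[b]> = G.
  rewrite -norm_joinEr // norms_cycle ab groupV; exact: cycle_id.
exists a, b.
have oa : #[a] <= r by rewrite dvdn_leq ?order_dvdn ?ar //; lia.
have ob : #[b] <= 2 * s by rewrite dvdn_leq ?order_dvdn ?bs //; lia.
have := mul_cardG <[a]> <[b]>; rewrite defG' -!orderE => cardM.
have cap_gt0 := cardG_gt0 (<[a]> :&: <[b]>).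
have cardG := leq_card_M2rs.
have r_gt0 : 0 < r by lia.
have s2_gt0 : 0 < 2 * s by lia.
have [-> -> c1] := tight_product r_gt0 s2_gt0 cap_gt0 oa ob cardG cardM.
by split=> //; apply: card1_trivg.
Qed.

Lemma M2rs_multipartite m : m %| r -> r %| 2 * m -> (forall i, r %| 2 * i -> m %| i) ->
  exists p : noncommuting_graph G -> 'I_m.-1.+2,
    multipartite (m.-1 * (r %/ m * s)) (r %/ m * s) p.
Proof.
move=> m_r r_2m m_i.
have [a [b [defG oa ob tiab ab]]] := M2rs_generators.
have m_gt0 : 0 < m by apply: dvdn_gt0 m_r; lia.
have Ga : a \in G by rewrite -defG (subsetP (mulG_subl _ _)) ?cycle_id.
have Gb : b \in G by rewrite -defG (subsetP (mulG_subr _ _)) ?cycle_id.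
have a2_neq1 : a ^+ 2 != 1 by rewrite -order_dvdn oa gtnNdvd.
have cab2 : a ^ (b ^+ 2) = a by rewrite expgS expg1 conjgM ab conjVg ab invgK.
have {}cab2 : commute a (b ^+ 2) by apply/commgP/conjg_fixP.
have cAB2 : <[b ^+ 2]> \subset 'C(<[a]>).
  by apply/cents_cycle/commute_sym.
pose H := (<[a]> <*> <[b ^+ 2]>)%G.
have defH : H = <[a]> * <[b ^+ 2]> :> {set gT} by rewrite /= cent_joinEr.
have ob2 : #[b ^+ 2] = s by rewrite orderXdiv ob ?mulKn // dvdn_mulr.
have tiab2 : <[a]> :&: <[b ^+ 2]> = 1.
  by apply/trivgP; rewrite -tiab setIS // cycleX.
have cardH : #|H| = (r * s)%N by rewrite defH TI_cardMg // -!orderE oa ob2.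
have cardG : #|G| = (r * (2 * s))%N by rewrite -defG TI_cardMg // -!orderE oa ob.
have abelH : abelian H.
  by rewrite abelianY !cycle_abelian.
have sHG : H \subset G by rewrite join_subG !cycle_subG Ga groupX.
have indexGH : #|G : H| = 2.
  by rewrite -divgS // cardG cardH mulnCA mulnK // muln_gt0 s_gt0; lia.
have nabelG : ~~ abelian G.
  apply: contra a2_neq1 => /centsP cGG; have := cGG _ Ga _ Gb.
  by move=> /commgP/conjg_fixP; rewrite ab expgS expg1 => {1}<-; rewrite mulVg.
have defZ : 'Z(G) = <[a ^+ m]> * <[b ^+ 2]>.
  have sZH := center_sub_abelian_index2 sHG indexGH abelH nabelG.
  have b2Z : b ^+ 2 \in 'Z(G).
    apply/centerP; split=> [|y]; first by rewrite groupX.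
    rewrite -defG => /mulsgP[_ _ /cycleP[i ->] /cycleP[j ->] ->].
    apply: commuteM; last exact: commuteX2.
    exact/commuteX/commute_sym.
  (* Being central amounts to commuting with [b], which inverts [a ^ i], that is, to
     [a ^ (2 i) = 1]. *)
  have ai_Z i : (a ^+ i \in 'Z(G)) = (r %| 2 * i).
    rewrite -oa order_dvdn; apply/idP/eqP => [/centerP[_ /(_ _ Gb)]|ai].
      move=> /commgP/conjg_fixP; rewrite conjXg ab => aiV.
      rewrite mul2n -addnn expgD -{1}aiV -expgMn ?mulVg ?expg1n //.
      by apply/commute_sym/commuteV.
    apply/centerP; split=> [|y]; first by rewrite groupX.
    rewrite -defG => /mulsgP[_ _ /cycleP[k ->] /cycleP[j ->] ->].
    apply: commuteM; first by apply: commuteX2.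
    apply: commuteX; apply/commgP/conjg_fixP; rewrite conjXg ab expVgn.
    by apply/eqP; rewrite eq_invg_mul -expgD addnn -mul2n ai.
  apply/eqP; rewrite eqEsubset; apply/andP; split.
    apply/subsetP => x Zx; have := subsetP sZH x Zx.
    rewrite defH => /mulsgP[_ _ /cycleP[i ->] /cycleP[j ->] defx].
    rewrite defx mem_mulg ?mem_cycle //.
    (* The other factor of [x] is a power of the central [b ^ 2]. *)
    have : a ^+ i \in 'Z(G).
      by rewrite -(mulgK ((b ^+ 2) ^+ j) (a ^+ i)) -defx groupM // groupV groupX.
    by rewrite ai_Z => /m_i/dvdnP[c ->]; rewrite mulnC expgM mem_cycle.
  by rewrite mul_subG ?cycle_subG // ai_Z.
have cardZ : #|'Z(G)| = (r %/ m * s)%N.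
  rewrite defZ TI_cardMg; last by apply/trivgP; rewrite -tiab2 setSI // cycleX.
  by rewrite -!orderE ob2 orderXdiv oa.
apply: (noncommuting_graph_multipartite sHG indexGH abelH nabelG cardZ).
by rewrite prednK // cardH mulnA [(m * _)%N]mulnC divnK.
Qed.
End Presentation.

Theorem theorem2p11 (r s : nat) (hr : (3 <= r)%N) (hs : (1 <= s)%N)
    (gT : finGroupType) (G : {group gT}) (hG : is_M2rs r s G) :
  let g := noncommuting_graph G in
  (energy g <= signless_laplacian_energy g
   /\ signless_laplacian_energy g <= laplacian_energy g
   /\ (energy g = signless_laplacian_energy g <-> r = 4%N)
   /\ (signless_laplacian_energy g = laplacian_energy g <-> r = 4%N))
  /\ (~ hypoenergetic g /\ ~ hyperenergetic g)
  /\ ((r = 3%N /\ s = 1%N -> L_hyperenergetic g /\ ~ Q_hyperenergetic g)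
      /\ (r = 4%N -> ~ L_hyperenergetic g /\ ~ Q_hyperenergetic g)
      /\ (~ (r = 3%N /\ s = 1%N) /\ r <> 4%N ->
          Q_hyperenergetic g /\ L_hyperenergetic g)).
Proof.
have [m [z [r_2m m_i m_r zE [z_gt0 r_m]]]] := M2rs_parameters hr hs.
have [p] := M2rs_multipartite hr hs hG m_r r_2m m_i; rewrite zE => mp.
have k_gt0 : (0 < m.-1)%N by lia.
(* The order of [algR] is by definition that of [algC], so [erefl] proves monotonicity. *)
have [EQL hypo r3 r4 large] :=
  blowup_comparison (f := algRval) (fun x y => erefl) mp k_gt0 z_gt0.
have k1_r4 : m.-1 = 1%N <-> r = 4%N by lia.
split; first by move: EQL; rewrite k1_r4.
split=> //; split; [case=> r_eq s_eq | split=> [r_eq | [rs_neq r_neq]]].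
- by apply: r3; lia.
- by apply: r4; lia.
(* If [z = 1], then [s = 1] and [r = m] is odd and not 3, so that [k = r - 1] is at least 4. *)
by apply: large; lia.
Qed.
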